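(* Let $a>0$ and $p(z)=a\,\dfrac{1+z}{1-z}$ for $z\in D$. Then $p$ is holomorphic on $D$ with $\mathrm{Re}(p(z))\ge0$ for all $z\in D$ and $p(0)=a$, yet, with $f(z)=-z\,p(z)$, $$\lambda_{\mathrm{local}}(-r)=2a\,\frac{(1-r)^2}{(1+r)^2}<2a\qquad\text{for every }r\in(0,1).$$
   Context: $D=\{z\in\mathbb{C}:|z|<1\}$. For a holomorphic $f:D\to\mathbb{C}$, $$\lambda_{\mathrm{local}}(z)=-\left[\frac{4\,\mathrm{Re}(\bar z f(z))}{1-|z|^2}+2\,\mathrm{Re}(f'(z))\right],\qquad z\in D.$$ *)

(* Defs.v *)
From Stdlib Require Export Reals.
From Coquelicot Require Export Coquelicot.

Open Scope R_scope.

Definition unit_disc (z : C) : Prop := Cmod z < 1.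

(* Holomorphy on an open set [U]: complex differentiability at every point.
   [C_NormedModule] is given explicitly because [C] also carries a real normed
   space structure. *)
Definition holomorphic_on (U : C -> Prop) (f : C -> C) : Prop :=
  forall z : C, U z -> @ex_derive C_AbsRing C_NormedModule f z.

(* Meant for [f] holomorphic on the unit disc and [z] in it. [C_derive] is a
   total operator, computed from difference quotients along the real direction;
   where [f] is complex differentiable it is the complex derivative
   ([C_derive_correct]). *)
Definition lambda_local (f : C -> C) (z : C) : R :=
  - (4 * Re (Cconj z * f z)%C / (1 - (Cmod z) ^ 2) + 2 * Re (C_derive f z)).

(* Main.v *)
Require Import Defs.
From Stdlib Require Import Lra Psatz.

(** Dividing by [1 - z] turns both functions of the theorem into partial
    fractions,
    [[
      p(z) = - a + 2 a / (1 - z),      f(z) = 2 a + a z - 2 a / (1 - z),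
    ]]
    so a single derivative computation, that of
    [z |-> alpha + beta z + gamma / (1 - z)] ([is_derive_partial_fraction]),
    gives the holomorphy of both and the formula
    [f'(z) = a - 2 a / (1 - z)^2].

    The real part of [p] is nonnegative because the Cayley map
    [z |-> (1 + z) / (1 - z)] sends the disc to the right half plane: its real
    part is [(1 - |z|^2) / |1 - z|^2] ([Re_cayley]).

    At [z = - r] everything is real:
    [[
      4 Re (conj z f(z)) / (1 - |z|^2) = - 4 a r^2 / (1 + r)^2,
      2 Re f'(z)                       = 2 a - 4 a / (1 + r)^2,
    ]]
    and the sum is [- 2 a (1 - r)^2 / (1 + r)^2]. The strict bound holds because
    [0 < 1 - r < 1 + r]. *)

(** A quadratic remainder is [o(|y - z|)]. This reduces a complex derivative to
    one inequality on moduli, without product or quotient rules. *)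
Lemma is_derive_of_quadratic_remainder (f : C -> C) (z l : C) (M d : R) :
  0 < d ->
  (forall y : C, Cmod (y - z) < d ->
     Cmod (f y - f z - (y - z) * l)%C <= M * Cmod (y - z) ^ 2) ->
  @is_derive C_AbsRing C_NormedModule f z l.
Proof.
  intros Hd Hf; split.
  - apply is_linear_scal_l.
  - intros x Hx eps.
    apply (@is_filter_lim_locally_unique C_AbsRing (AbsRing_NormedModule C_AbsRing)) in Hx.
    subst x.
    pose proof (cond_pos eps) as He.
    pose proof (Rabs_pos M) as HM.
    (* On this radius [M * |y - z| <= eps]; the [+ 1] covers [M = 0]. *)
    assert (Hrad : 0 < Rmin d (eps / (Rabs M + 1))).
    { apply Rmin_pos; [lra | apply Rdiv_lt_0_compat; lra]. }
    exists (mkposreal _ Hrad); intros y Hy.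
    change (Cmod (y - z) < Rmin d (eps / (Rabs M + 1))) in Hy.
    change (Cmod (f y - f z - (y - z) * l)%C <= eps * Cmod (y - z)).
    assert (Hyd : Cmod (y - z) < d) by (eapply Rlt_le_trans; [exact Hy | apply Rmin_l]).
    assert (Hye : Cmod (y - z) < eps / (Rabs M + 1))
      by (eapply Rlt_le_trans; [exact Hy | apply Rmin_r]).
    apply Rle_trans with (1 := Hf y Hyd).
    pose proof (Cmod_ge_0 (y - z)) as Hy0.
    apply Rlt_div_r in Hye; [| lra].
    pose proof (Rle_abs M).
    nra.
Qed.

Lemma locally_unit_disc (z : C) :
  unit_disc z -> @locally (AbsRing_UniformSpace C_AbsRing) z unit_disc.
Proof.
  unfold unit_disc; intros Hz.
  assert (Hrad : 0 < 1 - Cmod z) by lra.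
  exists (mkposreal _ Hrad); intros y Hy.
  change C in (type of y); change (Cmod (y - z) < 1 - Cmod z) in Hy.
  pose proof (Cmod_triangle (y - z) z) as T.
  replace (y - z + z)%C with y in T by ring; lra.
Qed.

Lemma one_minus_neq_0_of_unit_disc (z : C) : unit_disc z -> (RtoC 1 - z)%C <> RtoC 0.
Proof.
  unfold unit_disc; intros Hz H.
  assert (E : z = RtoC 1) by (replace z with (1 - (1 - z))%C by ring; rewrite H; ring).
  rewrite E, Cmod_1 in Hz; lra.
Qed.

(** Subtracting the linear part of [1 / (1 - y)] at [z] leaves exactly
    [(y - z)^2 / ((1 - y) (1 - z)^2)], and [|1 - y|] stays above
    [|1 - z| / 2] for [y] near [z]. *)
Lemma is_derive_partial_fraction (alpha beta gamma z : C) :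
  (RtoC 1 - z)%C <> RtoC 0 ->
  @is_derive C_AbsRing C_NormedModule
    (fun y : C => alpha + beta * y + gamma / (RtoC 1 - y))%C z
    (beta + gamma / ((RtoC 1 - z) * (RtoC 1 - z)))%C.
Proof.
  intros Hz.
  pose proof (proj1 (Cmod_gt_0 _) Hz) as Hm.
  apply is_derive_of_quadratic_remainder
    with (M := Cmod gamma * (2 / Cmod (1 - z) ^ 3)) (d := Cmod (1 - z) / 2).
  { lra. }
  intros y Hy.
  assert (Hlow : Cmod (1 - z) / 2 <= Cmod (1 - y)).
  { pose proof (Cmod_triangle (1 - y) (y - z)) as T.
    replace (1 - y + (y - z))%C with (1 - z)%C in T by ring; lra. }
  assert (Hy1 : (RtoC 1 - y)%C <> RtoC 0) by (apply Cmod_gt_0; lra).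
  match goal with |- Cmod ?e <= _ =>
    replace e with (gamma * ((y - z) * (y - z)) / ((1 - y) * ((1 - z) * (1 - z))))%C
      by (field; auto)
  end.
  rewrite Cmod_div by (repeat apply Cmult_neq_0; auto).
  rewrite !Cmod_mult.
  pose proof (Cmod_ge_0 gamma) as Hg.
  pose proof (Cmod_ge_0 (y - z)) as Hyz.
  set (m := Cmod (1 - z)) in *; set (k := Cmod (1 - y)) in *.
  set (t := Cmod (y - z)) in *.
  replace (Cmod gamma * (2 / m ^ 3) * t ^ 2)
    with (Cmod gamma * (t * t) / (m / 2 * (m * m))) by (field; lra).
  apply Rmult_le_compat_l; [apply Rmult_le_pos; nra |].
  assert (0 < m * m) by nra.
  apply Rinv_le_contravar; nra.
Qed.

(** Multiplying [(1 + z) / (1 - z)] above and below by the conjugate of [1 - z]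
    makes the denominator real. *)
Lemma Re_cayley (z : C) :
  (RtoC 1 - z)%C <> RtoC 0 ->
  Re ((RtoC 1 + z) / (RtoC 1 - z))%C = (1 - Cmod z ^ 2) / Cmod (1 - z) ^ 2.
Proof.
  intros Hz.
  pose proof (proj1 (Cmod_gt_0 _) Hz) as Hm.
  assert (Hm2 : 0 < Cmod (1 - z) ^ 2) by nra.
  rewrite !Cmod2_alt in *.
  destruct z as [x y]; simpl in *.
  field; lra.
Qed.

Theorem proposition7 :
  forall (a : R), 0 < a ->
  let p : C -> C := fun z => (RtoC a * ((RtoC 1 + z) / (RtoC 1 - z)))%C in
  let f : C -> C := fun z => (- z * p z)%C in
  holomorphic_on unit_disc p /\
  (forall z : C, unit_disc z -> 0 <= Re (p z)) /\
  p (RtoC 0) = RtoC a /\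
  holomorphic_on unit_disc f /\
  (forall r : R, 0 < r < 1 ->
     lambda_local f (RtoC (- r)) = 2 * a * ((1 - r) ^ 2 / (1 + r) ^ 2) /\
     2 * a * ((1 - r) ^ 2 / (1 + r) ^ 2) < 2 * a).
Proof.
  intros a Ha p f.
  (* [p] and [f] differ from their partial fractions at [y = 1], where [/ 0] is
     [0], so the comparison is on the disc and derivatives are transferred
     locally. *)
  assert (Hp : forall y, unit_disc y ->
    (- a + 0 * y + (2 * a) / (RtoC 1 - y))%C = p y).
  { intros y Hy; unfold p; field; exact (one_minus_neq_0_of_unit_disc y Hy). }
  assert (Hf : forall y, unit_disc y ->
    (2 * a + a * y + - (2 * a) / (RtoC 1 - y))%C = f y).
  { intros y Hy; unfold f, p; field; exact (one_minus_neq_0_of_unit_disc y Hy). }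
  assert (Hdf : forall z, unit_disc z ->
    @is_derive C_AbsRing C_NormedModule f z
      (a + - (2 * a) / ((RtoC 1 - z) * (RtoC 1 - z)))%C).
  { intros z Hz.
    eapply is_derive_ext_loc;
      [| exact (is_derive_partial_fraction (2 * a) a (- (2 * a)) z
                  (one_minus_neq_0_of_unit_disc z Hz))].
    exact (filter_imp _ _ Hf (locally_unit_disc z Hz)). }
  refine (conj _ (conj _ (conj _ (conj _ (fun r Hr => conj _ _))))).
  - intros z Hz; eexists.
    eapply is_derive_ext_loc;
      [| exact (is_derive_partial_fraction (- a) 0 (2 * a) z
                  (one_minus_neq_0_of_unit_disc z Hz))].
    exact (filter_imp _ _ Hp (locally_unit_disc z Hz)).
  - intros z Hz; unfold p.
    pose proof (one_minus_neq_0_of_unit_disc z Hz) as Hn.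
    rewrite re_scal_l, Re_cayley by exact Hn.
    apply Rmult_le_pos; [lra |].
    apply Cmod_gt_0 in Hn.
    pose proof (Cmod_ge_0 z); unfold unit_disc in Hz.
    apply Rdiv_le_0_compat; nra.
  - unfold p; field.
  - intros z Hz; eexists; exact (Hdf z Hz).
  - assert (Hz : unit_disc (RtoC (- r))).
    { unfold unit_disc; rewrite Cmod_R, Rabs_left; lra. }
    unfold lambda_local.
    rewrite (is_C_derive_unique _ _ _ (Hdf _ Hz)), <- (Hf _ Hz), Cmod_R.
    assert (Ec : Cconj (RtoC (- r)) = RtoC (- r))
      by (unfold Cconj; simpl; rewrite Ropp_0; reflexivity).
    rewrite Ec, <- !RtoC_minus, <- !RtoC_mult, <- !RtoC_opp.
    assert (Hd : 1 - - r <> 0) by lra.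
    pose proof (Rmult_integral_contrapositive_currified _ _ Hd Hd) as Hd2.
    rewrite <- !RtoC_div by assumption.
    rewrite <- !RtoC_plus, <- !RtoC_mult, !re_RtoC, pow2_abs.
    field; split; apply Rgt_not_eq; nra.
  - assert (Hq : (1 - r) ^ 2 / (1 + r) ^ 2 < 1).
    { assert (Hden : 0 < (1 + r) ^ 2) by nra.
      apply (proj1 (Rdiv_lt_1 _ _ Hden)); nra. }
    apply Rmult_lt_compat_l with (r := 2 * a) in Hq; lra.
Qed.
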